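(* Let $d\ge 0$ be an integer, let $G$ be any finite $d$-regular graph and let $\lambda>0$. Then \[ \alpha_G(\lambda) \le \alpha_{K_{d+1}}(\lambda), \] with equality if and only if $G$ is a disjoint union of copies of $K_{d+1}$.
   Context: Graphs are finite, simple and have at least one vertex. A Widom--Rowlinson configuration on a graph $G$ is a map $\chi:V(G)\to\{0,1,2\}$ such that no vertex coloured $1$ is adjacent to a vertex coloured $2$. Let $\Omega(G)$ be the set of such configurations and $X_i(\chi)$ the number of vertices coloured $i$. The Widom--Rowlinson model on $G$ with activity $\lambda>0$ is the probability distribution on $\Omega(G)$ given by $\mathbb{P}[\chi]=\lambda^{X_1(\chi)+X_2(\chi)}/P_G(\lambda)$, where $P_G(\lambda)=\sum_{\chi\in\Omega(G)}\lambda^{X_1(\chi)+X_2(\chi)}$ is the partition function. The occupancy fraction is $\alpha_G(\lambda)=\mathbb{E}[X_1+X_2]/|V(G)|$, the expectation being over $\chi$ drawn from this model. $K_{d+1}$ denotes the complete graph on $d+1$ vertices. *)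

(* Defs.v *)
From HB Require Import structures.
From mathcomp Require Import all_boot all_order all_algebra.
From mathcomp Require Import reals.
Set Implicit Arguments. Unset Strict Implicit. Unset Printing Implicit Defensive.
Import Order.TTheory GRing.Theory Num.Theory.
Local Open Scope ring_scope.

Definition simple_graph (T : finType) (e : rel T) : Prop :=
  symmetric e /\ irreflexive e.

Definition regular (T : finType) (e : rel T) (d : nat) : Prop :=
  forall x : T, #|[set y | e x y]| = d.

Definition wr_config (T : finType) (e : rel T) (chi : {ffun T -> 'I_3}) : bool :=
  [forall x, forall y, e x y ==> ~~ ((val (chi x) == 1%N) && (val (chi y) == 2%N))].

Definition occ (T : finType) (chi : {ffun T -> 'I_3}) : nat :=
  #|[set x | val (chi x) == 1%N]| + #|[set x | val (chi x) == 2%N]|.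

Definition wr_partition (R : realType) (T : finType) (e : rel T) (lam : R) : R :=
  \sum_(chi : {ffun T -> 'I_3} | wr_config e chi) lam ^+ occ chi.

(* occupancy fraction alpha_G(lam) = E[X_1 + X_2] / |V(G)| *)
Definition occupancy_fraction (R : realType) (T : finType) (e : rel T) (lam : R) : R :=
  (\sum_(chi : {ffun T -> 'I_3} | wr_config e chi) (occ chi)%:R * lam ^+ occ chi)
  / (wr_partition e lam * #|T|%:R).

Definition complete_rel (n : nat) : rel 'I_n := fun i j => i != j.

Definition disjoint_union_of_cliques (T : finType) (e : rel T) (d : nat) : Prop :=
  exists m : nat, exists phi : T -> 'I_m * 'I_d.+1,
    bijective phi /\
    forall x y, e x y = ((phi x).1 == (phi y).1) && ((phi x).2 != (phi y).2).

(* Main.v *)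
Require Import Defs.
From mathcomp Require Import all_boot all_order all_algebra.
From mathcomp Require Import reals ring lra.
Import Order.TTheory GRing.Theory Num.Theory.
Set Implicit Arguments. Unset Strict Implicit. Unset Printing Implicit Defensive.
Local Open Scope ring_scope.

(* Write s = 1 + lam and view a configuration as a pair (A, B) of colour classes: A must
   avoid the closed neighbourhood N[B]. A linear-programming duality argument compares G with
   K_{d+1}: the quantity
     2 lam s^d |V| - (2 s^(d+1) - 1) (|A| + |B|),
   whose expectation is a positive multiple of alpha_{K_{d+1}} - alpha_G, is by d-regularity
   a sum over vertices v of terms depending only on (A, B) near v, and each term splits as
   h_v(A, B) + h_v(B, A). It thus suffices to sum h_v over A for a fixed B. Since A ranges
   over all subsets of V \ N[B], this sum factors and leaves a sum over subsets of
   K = N[v] \ N[B], computed in closed form and nonnegative because n / (1 - s^-n) is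
   nondecreasing. It is strictly positive as soon as B meets N[v] and K is nonempty; the
   choice B = {z} shows that equality forces "equal or adjacent" to be transitive, and
   conversely transitivity makes every local sum vanish. *)

(** * Weighted sums over the subsets of a finite set *)

Section SubsetSums.
Variables (R : comNzRingType) (T : finType) (lam : R).
Implicit Types (K C A : {set T}).

Lemma sum_subset_expr K :
  \sum_(A : {set T} | A \subset K) lam ^+ #|A| = (1 + lam) ^+ #|K|.
Proof.
pose F i := if i \in K then lam else 0.
(* Expanding this product gives one term per set [A]; it vanishes unless [A] lies in [K]. *)
transitivity (\prod_(i : T) (F i + 1)).
  rewrite bigA_distr big_mkcond /=; apply: eq_bigr => A _.
  case: ifPn => [/subsetP sAK|/subsetPn[x xA xK]].
    rewrite -big_mkcond /= (eq_bigr (fun=> lam)) ?prodr_const //.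
    by move=> i iA; rewrite /F sAK.
  by rewrite (bigD1 x) //= xA /F (negbTE xK) mul0r.
rewrite (bigID (mem K)) /= [X in _ * X]big1 ?mulr1 => [|i iK]; last first.
  by rewrite /F (negbTE iK) add0r.
rewrite (eq_bigr (fun=> 1 + lam)) ?prodr_const // => i iK.
by rewrite /F iK addrC.
Qed.

(** The weight is multiplicative over the split of [A] into its trace on [C] and the rest; the rest
    ranges freely over subsets of [K :\: C]. *)
Lemma sum_subset_split K C (f : {set T} -> R) :
  \sum_(A : {set T} | A \subset K) f (A :&: C) * lam ^+ #|A| =
  (1 + lam) ^+ #|K :\: C| *
    \sum_(A : {set T} | A \subset K :&: C) f A * lam ^+ #|A|.
Proof.
rewrite (partition_big (fun A => A :&: C) (fun A => A \subset K :&: C)) /=;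
  last by move=> A sAK; rewrite setSI.
rewrite mulr_sumr; apply: eq_bigr => A1 sA1.
rewrite -sum_subset_expr mulr_suml.
rewrite (reindex_onto (fun A0 => A1 :|: A0) (fun A => A :\: C)) /=; last first.
  by move=> A /andP[_ /eqP <-]; rewrite setID.
have /subsetIP[sA1K sA1C] := sA1.
apply: eq_big => [A0|A0 /andP[/andP[_ /eqP ->] /eqP A0E]].
  rewrite subsetD subUset sA1K /= setIUl (setIidPl sA1C) setDUl.
  have -> : A1 :\: C = set0 by apply/eqP; rewrite setD_eq0.
  rewrite set0U -andbA; congr (_ && _).
  rewrite -setI_eq0; apply/andP/eqP => [[_ /eqP <-]|A0C].
    by rewrite setDE -setIA (setIC (~: C)) setICr setI0.
  by rewrite A0C setU0 eqxx; split=> //; apply/eqP/setDidPl; rewrite -setI_eq0 A0C.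
have dis : A1 :&: A0 = set0.
  apply/eqP; rewrite setI_eq0 -A0E disjoints_subset.
  by apply: subset_trans sA1C _; rewrite setDE setCI setCK subsetUr.
rewrite cardsU dis cards0 subn0 exprD; ring.
Qed.

Lemma sum_subset_mem K x :
  \sum_(A : {set T} | A \subset K) (x \in A)%:R * lam ^+ #|A| =
  (x \in K)%:R * (lam * (1 + lam) ^+ #|K|.-1).
Proof.
rewrite (eq_bigr (fun A => (x \in A :&: [set x])%:R * lam ^+ #|A|)); last first.
  by move=> A _; rewrite !inE eqxx andbT.
rewrite (sum_subset_split K [set x] (fun A => (x \in A)%:R)).
have [xK|xK] := boolP (x \in K); last first.
  rewrite mul0r big1 ?mulr0 // => A sA.
  case: (boolP (x \in A)) => [/(subsetP sA)|]; last by rewrite mul0r.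
  by rewrite !inE (negbTE xK).
rewrite mul1r mulrC; congr (_ * (1 + lam) ^+ _); last first.
  by rewrite (cardsD1 x K) xK.
rewrite (bigD1 [set x]) /=; last by rewrite subsetI sub1set xK subxx.
rewrite big1 ?addr0 => [|A /andP[]]; first by rewrite inE eqxx cards1 mul1r.
by rewrite subsetI subset1 => /andP[_ /orP[/eqP ->|/eqP ->]]; rewrite ?eqxx // inE mul0r.
Qed.

Lemma sum_subset_card K C :
  \sum_(A : {set T} | A \subset K) #|A :&: C|%:R * lam ^+ #|A| =
  #|K :&: C|%:R * (lam * (1 + lam) ^+ #|K|.-1).
Proof.
have cardE A : #|A :&: C|%:R = \sum_(x in C) (x \in A)%:R :> R.
  rewrite -sum1_card natr_sum big_mkcond [RHS]big_mkcond /=.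
  by apply: eq_bigr => x _; rewrite inE andbC; case: (x \in C); case: (x \in A).
rewrite cardE mulr_suml; under eq_bigr do rewrite cardE mulr_suml.
by rewrite exchange_big; apply: eq_bigr => x _; apply: sum_subset_mem.
Qed.

End SubsetSums.

(** * Inequalities of Bernoulli type *)

Section PowerBounds.
Variables (R : realDomainType) (s : R).

Lemma bernoulli_expr n : 0 <= s -> n%:R * (s - 1) <= s ^+ n - 1.
Proof.
move=> s0; have s1 := sqr_ge0 (s - 1).
elim: n => [|n IH]; first by rewrite expr0 mul0r subrr.
have n0 : 0 <= n%:R :> R by [].
rewrite exprS -natr1; nra.
Qed.

Lemma expr_sub1_le n : 1 <= s -> s ^+ n - 1 <= n%:R * (s - 1) * s ^+ n.
Proof.
move=> s1; have sn1 : 1 <= s ^+ n by rewrite exprn_ege1.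
elim: n sn1 => [|n IH] sn1; first by rewrite expr0 !mul0r subrr.
have n0 : 0 <= n%:R :> R by [].
have h : 1 <= s ^+ n by rewrite exprn_ege1.
have := IH h; rewrite exprS -natr1 => {}IH.
have : s * (s ^+ n - 1) <= s * (n%:R * (s - 1) * s ^+ n) by rewrite ler_wpM2l //; lra.
have : (s - 1) * 1 <= (s - 1) * (s * s ^+ n) by rewrite ler_wpM2l //; nra.
nra.
Qed.

(* [n / (1 - s ^- n)] is nondecreasing in [n]. *)
Lemma expr_ratio_le k d : 1 <= s -> (k <= d)%N ->
  k%:R * s ^+ k * (s ^+ d - 1) <= d%:R * s ^+ d * (s ^+ k - 1).
Proof.
(* With d = k + j, right side minus left side is s^k (j s^j (s^k - 1) - k (s^j - 1)). Both terms in
   the bracket are compared with k j (s - 1) s^j. *)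
move=> s1 /subnKC <-; set j := (d - k)%N; rewrite exprD natrD.
have bk := bernoulli_expr k (le_trans ler01 s1).
have bj := expr_sub1_le j s1.
have sk1 : 1 <= s ^+ k by rewrite exprn_ege1.
have sj1 : 1 <= s ^+ j by rewrite exprn_ege1.
have k0 : 0 <= k%:R :> R by [].
have j0 : 0 <= j%:R :> R by [].
have h1 : k%:R * (s ^+ j - 1) <= k%:R * (j%:R * (s - 1) * s ^+ j) by rewrite ler_wpM2l.
have h2 : j%:R * s ^+ j * (k%:R * (s - 1)) <= j%:R * s ^+ j * (s ^+ k - 1).
  by rewrite ler_wpM2l // mulr_ge0 //; lra.
have : s ^+ k * (k%:R * (s ^+ j - 1)) <= s ^+ k * (j%:R * s ^+ j * (s ^+ k - 1)).
  by rewrite ler_wpM2l //; lra.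
rewrite -subr_ge0 => h3; rewrite -subr_ge0; apply: le_trans h3 _; lra.
Qed.

End PowerBounds.

(** * Local gaps for a reflexive symmetric relation with balls of size d + 1 *)

Section ClosedNeighbourhoods.
Variables (R : realFieldType) (T : finType) (r : rel T) (d : nat) (lam : R).
Hypotheses (rr : reflexive r) (rs : symmetric r).
Implicit Types (A B : {set T}) (v : T).

Definition ball v := [set u | r v u].
Definition far B := [set a | [disjoint ball a & B]].

Hypotheses (cardball : forall v, #|ball v| = d.+1) (lam0 : 0 < lam).

Lemma far_sym A B : (A \subset far B) = (B \subset far A).
Proof.
suff imp (X Y : {set T}) : X \subset far Y -> Y \subset far X by apply/idP/idP; apply: imp.
move/subsetP=> XY; apply/subsetP => y yY; rewrite inE disjoint_subset.
apply/subsetP => x; rewrite inE rs => yx; apply/negP => xX.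
by move: (XY x xX); rewrite inE => /disjointFl/(_ yY); rewrite inE yx.
Qed.

Local Notation s := (1 + lam).

(* Solves [slope * d = s ^+ d - 1], also for [d = 0] since then both sides vanish. *)
Definition slope : R := (s ^+ d - 1) / d%:R.

Let s1 : 1 < s. Proof. by rewrite ltrDl. Qed.

Lemma slopeE : slope * d%:R = s ^+ d - 1.
Proof.
rewrite /slope; have [->|d0] := posnP d; first by rewrite expr0 subrr !mul0r.
by rewrite divfK // pnatr_eq0 -lt0n.
Qed.

Lemma slope_ge0 : 0 <= slope.
Proof. by rewrite divr_ge0 ?ler0n // subr_ge0 exprn_ege1 // ltW. Qed.

Lemma slope_gt0 : (0 < d)%N -> 0 < slope.
Proof. by move=> d0; rewrite divr_gt0 ?ltr0n // subr_gt0 exprn_egt1 // -lt0n. Qed.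

(** This is [expr_ratio_le] with s^d - 1 written as [slope * d] and d cancelled; d = 0 leaves only k
    = 0. *)
Lemma slope_le k : (k <= d)%N -> slope * k%:R * s ^+ k <= s ^+ d * (s ^+ k - 1).
Proof.
move=> kd; have [d0|d0] := posnP d.
  move: kd; rewrite d0 leqn0 => /eqP ->.
  by rewrite !expr0 !mulr0 mul0r subrr mulr0.
rewrite -(ler_pM2l (_ : 0 < d%:R)) ?ltr0n //.
have := expr_ratio_le (ltW s1) kd; rewrite -slopeE => h.
have -> : d%:R * (slope * k%:R * s ^+ k) = k%:R * s ^+ k * (slope * d%:R) by ring.
by rewrite [leRHS]mulrA.
Qed.

(* The coefficients come from the optimal dual solution: they make [half_gap] sum to zero on
   cliques while keeping the sums nonnegative on all other neighbourhoods. *)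
Definition half_gap v A B : R :=
  lam * s ^+ d * ((A :&: ball v != set0)%:R + (B :&: ball v == set0)%:R)
  - (2%:R * s ^+ d.+1 - s ^+ d) * (v \in A)%:R
  - slope * #|A :&: (ball v :\ v)|%:R.

Definition local_gap v B : R :=
  \sum_(A : {set T} | A \subset far B :&: ball v) half_gap v A B * lam ^+ #|A|.

Lemma mem_far v B : (v \in far B) = (B :&: ball v == set0).
Proof. by rewrite inE -setI_eq0 setIC. Qed.

Lemma local_gapE v B (K := far B :&: ball v) :
  local_gap v B =
  lam * s ^+ d * (s ^+ #|K| - 1 + (v \in K)%:R * s ^+ #|K|)
  - (2%:R * s ^+ d.+1 - s ^+ d) * ((v \in K)%:R * (lam * s ^+ #|K|.-1))
  - slope * (#|K :\ v|%:R * (lam * s ^+ #|K|.-1)).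
Proof.
have vK : (v \in K) = (B :&: ball v == set0).
  by rewrite inE mem_far [v \in ball v]inE rr andbT.
have KE : K :\ v = K :&: (ball v :\ v).
  by apply/setP => x; rewrite !inE; case: (x == v); case: (r v x); rewrite ?andbF ?andbT.
rewrite KE -sum_subset_card -sum_subset_mem !mulr_sumr.
have -> : s ^+ #|K| - 1 =
    \sum_(A : {set T} | A \subset K) (A :&: ball v != set0)%:R * lam ^+ #|A|.
  rewrite -sum_subset_expr (bigD1 set0) ?sub0set //= cards0 expr0 addrC addrK.
  rewrite [RHS](bigD1 set0) ?sub0set //= set0I eqxx mul0r add0r.
  by apply: eq_bigr => A /andP[/subsetIP[_ /setIidPl ->] ->]; rewrite mul1r.
rewrite -sum_subset_expr mulrDr !mulr_sumr -big_split /= -!sumrB.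
by apply: eq_bigr => A _; rewrite /half_gap -vK; ring.
Qed.

(** If [B] meets the ball, its centre [v] is not in [far B], so at least one of the d + 1 points is
    lost. *)
Lemma card_far_ball v B : B :&: ball v != set0 ->
  (#|far B :&: ball v| <= d)%N.
Proof.
move=> h; rewrite -ltnS -(cardball v) proper_card // properEneq subsetIr andbT.
apply: contraNneq h => /setP/(_ v); rewrite -mem_far inE [v \in ball v]inE rr andbT.
by move=> ->.
Qed.

(** Here [v] itself is available, so k counts the other available points of the ball. The bracket is
    the difference of the two sides of [slope_le]. *)
Lemma local_gap_disjoint v B k : B :&: ball v = set0 -> #|far B :&: ball v| = k.+1 ->
  local_gap v B = lam * (s ^+ d * (s ^+ k - 1) - slope * k%:R * s ^+ k).
Proof.
move=> /eqP; rewrite -mem_far => vB cK; rewrite local_gapE.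
have vK : v \in far B :&: ball v by rewrite inE vB inE rr.
have : #|far B :&: ball v| = ((v \in far B :&: ball v) + #|(far B :&: ball v) :\ v|)%N.
  exact: cardsD1.
rewrite cK vK add1n => -[<-] /=; rewrite !exprS; ring.
Qed.

Lemma local_gap_meet v B : B :&: ball v != set0 ->
  local_gap v B = lam * (s ^+ d * (s ^+ #|far B :&: ball v| - 1)
    - slope * #|far B :&: ball v|%:R * s ^+ #|far B :&: ball v|.-1).
Proof.
rewrite -mem_far => vB; rewrite local_gapE.
have vK : v \notin far B :&: ball v by rewrite inE (negbTE vB).
rewrite (setDidPl _) ?(negbTE vK); last by rewrite disjoint_sym disjoints1.
rewrite !mul0r; ring.
Qed.

(** The slope term in [local_gap_meet] has one factor s > 1 fewer than in [slope_le], which makes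
    the inequality strict. A nonempty intersection forces d > 0 by [card_far_ball], hence a positive
    slope. *)
Lemma local_gap_meet_gt0 v B : B :&: ball v != set0 ->
  far B :&: ball v != set0 -> 0 < local_gap v B.
Proof.
move=> hB hK; rewrite local_gap_meet //; apply: mulr_gt0 => //.
have := card_far_ball hB; move: hK; rewrite -card_gt0.
case: #|_| => // k _ kd /=; rewrite subr_gt0.
apply: lt_le_trans (slope_le kd); rewrite ltr_pM2l; first by rewrite ltr_eXn2l.
by rewrite mulr_gt0 ?ltr0n ?slope_gt0 //; apply: leq_ltn_trans kd.
Qed.

Lemma local_gap_ge0 v B : 0 <= local_gap v B.
Proof.
have [hB|hB] := eqVneq (B :&: ball v) set0.
  case E: #|far B :&: ball v| => [|k].
    move/eqP: hB; rewrite -mem_far => vB; move/eqP: E; rewrite cards_eq0.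
    by move/eqP/setP/(_ v); rewrite inE vB !inE rr.
  rewrite (local_gap_disjoint hB E) mulr_ge0 ?(ltW lam0) // subr_ge0 slope_le //.
  by rewrite -ltnS -E -(cardball v) subset_leq_card // subsetIr.
have [hK|hK] := eqVneq (far B :&: ball v) set0; last exact/ltW/local_gap_meet_gt0.
by rewrite local_gap_meet // hK cards0 expr0 subrr !mulr0 mul0r subrr mulr0.
Qed.

Lemma local_gap_eq0P : (forall v B, local_gap v B = 0) <-> transitive r.
Proof.
split=> [gap0 y x z xy yz|rt v B].
  apply: contraT => nxz; have hB : [set z] :&: ball y != set0.
    by apply/set0Pn; exists z; rewrite !inE eqxx.
  suff /(local_gap_meet_gt0 hB) : far [set z] :&: ball y != set0 by rewrite gap0 ltxx.
  apply/set0Pn; exists x; rewrite !inE rs xy andbT disjoint_sym disjoints1.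
  by rewrite inE nxz.
(* Balls are now equivalence classes: if [B] misses the ball, all d + 1 points are available and
   [slopeE] gives zero; otherwise none is. *)
have [hB|hB] := eqVneq (B :&: ball v) set0.
  have hK : far B :&: ball v = ball v.
    apply/setIidPr/subsetP => a; rewrite inE => va; rewrite mem_far -subset0 -hB.
    by apply: setIS; apply/subsetP => x; rewrite !inE; apply: rt.
  rewrite (@local_gap_disjoint v B d) ?hK ?cardball // slopeE; ring.
rewrite local_gap_meet //; suff -> : far B :&: ball v = set0.
  by rewrite cards0 expr0 subrr !mulr0 mul0r subrr mulr0.
have [b] := set0Pn _ hB; rewrite inE => /andP[bB]; rewrite inE => vb.
apply/eqP; rewrite -subset0; apply/subsetP => a; rewrite in_setI => /andP[aB].
rewrite inE rs => av; move: aB; rewrite inE => /disjointFl/(_ bB).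
by rewrite inE (rt v).
Qed.

(** Double counting: each point of [A] lies in the punctured balls of exactly d points. *)
Lemma sum_card_ball A : (\sum_v #|A :&: (ball v :\ v)| = d * #|A|)%N.
Proof.
under eq_bigr do rewrite -sum1_card big_mkcond /=.
rewrite exchange_big /= mulnC -sum_nat_const [RHS]big_mkcond; apply: eq_bigr => x _.
have [xA|xA] := boolP (x \in A); last by rewrite big1 // => v _; rewrite inE (negbTE xA).
rewrite -big_mkcond sum1_card -[d]/(d.+1.-1) -(cardball x) (cardsD1 x) [x \in _]inE rr.
by apply: eq_card => v; rewrite -[LHS]/(x \in A :&: (ball v :\ v)) !inE xA /= rs eq_sym.
Qed.

(** After symmetrization the indicators that a set meets or misses the ball add up to 1 for each
    colour. The coefficients of |A| + |B| combine since [slope * d] is s^d - 1. *)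
Lemma sum_half_gap A B :
  \sum_v (half_gap v A B + half_gap v B A) =
  2%:R * lam * s ^+ d * #|T|%:R - (2%:R * s ^+ d.+1 - 1) * (#|A| + #|B|)%:R.
Proof.
have memE (X : {set T}) : \sum_v (v \in X)%:R = #|X|%:R :> R.
  by rewrite -sum1_card natr_sum [RHS]big_mkcond; apply: eq_bigr => v _; case: (v \in X).
transitivity (\sum_v (2%:R * lam * s ^+ d
    - (2%:R * s ^+ d.+1 - s ^+ d) * ((v \in A)%:R + (v \in B)%:R)
    - slope * (#|A :&: (ball v :\ v)| + #|B :&: (ball v :\ v)|)%:R)).
  apply: eq_bigr => v _; rewrite /half_gap natrD.
  set a := #|_|%:R; set b := #|_|%:R; move: slope (s ^+ d) (s ^+ d.+1) => th S S'.
  by case: (A :&: ball v == _); case: (B :&: ball v == _) => /=; ring.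
rewrite !sumrB sumr_const -!mulr_sumr big_split /= !memE -natr_sum big_split /=.
rewrite !sum_card_ball !natrD !natrM -mulrDr mulrA slopeE exprS.
have -> : #|(fun=> true) : pred T| = #|T| by apply: eq_card.
rewrite -[_ *+ #|T|]mulr_natr.
move: (s ^+ d) (#|A|%:R : R) (#|B|%:R : R) (#|T|%:R : R) => S a b n; ring.
Qed.

(** * Unnormalised expectations over compatible pairs of colour classes *)

Definition pair_sum (F : {set T} -> {set T} -> R) : R :=
  \sum_(B : {set T}) \sum_(A : {set T} | A \subset far B) F A B * lam ^+ (#|A| + #|B|).

Lemma pair_sum_swap F : pair_sum F = pair_sum (fun A B => F B A).
Proof.
rewrite /pair_sum (exchange_big_dep predT) //=; apply: eq_bigr => B _.
by apply: eq_big => [A|A _]; [rewrite far_sym | rewrite addnC].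
Qed.

(** For fixed [B], [half_gap] sees [A] only through its trace on the ball, so [sum_subset_split]
    factors out the points beyond it. *)
Lemma pair_sum_half_gap v :
  pair_sum (half_gap v) =
  \sum_(B : {set T}) lam ^+ #|B| * s ^+ #|far B :\: ball v| * local_gap v B.
Proof.
apply: eq_bigr => B _; rewrite -mulrA /local_gap -sum_subset_split mulr_sumr.
apply: eq_bigr => A _; rewrite exprD mulrA mulrC; congr (_ * (_ * _)).
rewrite /half_gap -!setIA setIid !inE rr andbT.
by congr (_ - _ - slope * #|_ :&: _|%:R); apply/setP => x; rewrite !inE andbCA andbb.
Qed.

Lemma pair_sum_gapE :
  pair_sum (fun A B => 2%:R * lam * s ^+ d * #|T|%:R
                       - (2%:R * s ^+ d.+1 - 1) * (#|A| + #|B|)%:R) =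
  2%:R * \sum_v pair_sum (half_gap v).
Proof.
have -> : \sum_v pair_sum (half_gap v) = pair_sum (fun A B => \sum_v half_gap v A B).
  rewrite /pair_sum exchange_big; apply: eq_bigr => B _; rewrite exchange_big.
  by apply: eq_bigr => A _; rewrite mulr_suml.
rewrite [RHS]mulr_natl [RHS]mulr2n [X in _ = _ + X]pair_sum_swap /pair_sum -big_split;
apply: eq_bigr => B _.
rewrite -big_split; apply: eq_bigr => A _ /=.
by rewrite -sum_half_gap big_split mulrDl.
Qed.

Lemma pair_sum_half_gap_ge0 v : 0 <= pair_sum (half_gap v).
Proof.
rewrite pair_sum_half_gap; apply: sumr_ge0 => B _.
rewrite mulr_ge0 ?local_gap_ge0 // mulr_ge0 // exprn_ge0 //; first exact: ltW.
by rewrite (le_trans ler01) // ltW.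
Qed.

Lemma pair_sum_half_gap_eq0P :
  (\sum_v pair_sum (half_gap v) = 0) <-> transitive r.
Proof.
rewrite -local_gap_eq0P; split=> [|gap0]; last first.
  by apply: big1 => v _; rewrite pair_sum_half_gap big1 // => B _; rewrite gap0 mulr0.
move/psumr_eq0P => /(_ (fun v _ => pair_sum_half_gap_ge0 v)) gap0 v B.
have c0 (X : {set T}) : 0 < lam ^+ #|X| * s ^+ #|far X :\: ball v|.
  by rewrite mulr_gt0 ?exprn_gt0 // (lt_trans ltr01).
have := gap0 v isT; rewrite pair_sum_half_gap => /psumr_eq0P h.
have /eqP := h (fun X _ => mulr_ge0 (ltW (c0 X)) (local_gap_ge0 v X)) B isT.
by rewrite mulf_eq0 gt_eqF //= => /eqP.
Qed.

End ClosedNeighbourhoods.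

(** * From colourings to pairs of sets, and the bound with its equality case *)

Section Configurations.
Variables (R : realType) (T : finType) (e : rel T) (d : nat) (lam : R).
Hypotheses (hsimple : simple_graph e) (hreg : regular e d) (lam0 : 0 < lam).

Definition refl_closure : rel T := fun x y => (x == y) || e x y.
Local Notation r := refl_closure.
Local Notation s := (1 + lam).

Lemma refl_closure_refl : reflexive r.
Proof. by move=> x; rewrite /refl_closure eqxx. Qed.

Lemma refl_closure_sym : symmetric r.
Proof. by move=> x y; rewrite /refl_closure eq_sym hsimple.1. Qed.

Lemma card_ball_refl_closure v : #|ball r v| = d.+1.
Proof.
have -> : ball r v = v |: [set y | e v y].
  by apply/setP => y; rewrite !inE eq_sym.
by rewrite cardsU1 hreg inE hsimple.2.
Qed.

Definition color_class (i : nat) (chi : {ffun T -> 'I_3}) : {set T} :=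
  [set x | val (chi x) == i].

(* The first component is the class of colour 2, the second that of colour 1. *)
Definition config_of (p : {set T} * {set T}) : {ffun T -> 'I_3} :=
  [ffun x => if x \in p.2 then inord 1 else if x \in p.1 then inord 2 else ord0].

Lemma wr_configE chi :
  wr_config e chi = (color_class 1 chi \subset far r (color_class 2 chi)).
Proof.
apply/'forall_forallP/subsetP => [h x|h x y].
  rewrite !inE => x1; rewrite disjoint_subset; apply/subsetP => y.
  rewrite !inE => /predU1P[<-|xy]; first by rewrite (eqP x1).
  by have := implyP (h x y) xy; rewrite x1.
apply/implyP => xy; apply/negP => /andP[x1 y2].
have := h x; rewrite !inE => /(_ x1) /disjointFr/(_ (_ : y \in _)).
by rewrite !inE /refl_closure xy orbT y2 => /(_ isT).
Qed.

Lemma config_ofK chi : config_of (color_class 2 chi, color_class 1 chi) = chi.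
Proof.
apply/ffunP => x; rewrite ffunE !inE; apply: val_inj.
by case: (chi x) => -[|[|[|//]]] ? /=; rewrite ?inordK.
Qed.

(** Each point lies in its own ball, so compatible [A] and [B] are disjoint and the precedence of
    colour 1 in [config_of] loses nothing. *)
Lemma color_classK (A B : {set T}) : A \subset far r B ->
  (color_class 2 (config_of (B, A)), color_class 1 (config_of (B, A))) = (B, A).
Proof.
move=> /subsetP AB; congr pair; apply/setP => x; rewrite inE ffunE /=; last first.
  by case: ifP => _; [|case: ifP => _]; rewrite ?inordK.
case: ifP => [/AB|_]; last by case: ifP => _; rewrite ?inordK.
by rewrite inE inordK // => /disjointFr/(_ (_ : x \in _)) -> //; rewrite inE refl_closure_refl.
Qed.

Lemma sum_wr_config (f : nat -> R) :
  \sum_(chi | wr_config e chi) f (occ chi) * lam ^+ occ chi =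
  pair_sum r lam (fun A B => f (#|A| + #|B|)%N).
Proof.
rewrite /pair_sum pair_big_dep /=.
rewrite (reindex_onto (fun chi => (color_class 2 chi, color_class 1 chi)) config_of) /=.
  by apply: eq_bigl => chi; rewrite wr_configE config_ofK eqxx andbT.
by move=> [B A] /color_classK.
Qed.

(** The closed form for the complete graph, whose partition function is 2 s^(d+1) - 1; see
    [occupancy_complete]. *)
Definition clique_occupancy : R := 2%:R * lam * s ^+ d / (2%:R * s ^+ d.+1 - 1).

Lemma clique_occupancy_den_gt0 : 0 < 2%:R * s ^+ d.+1 - 1.
Proof.
have : 1 <= s ^+ d.+1 by rewrite exprn_ege1 // lerDl ltW.
lra.
Qed.

Lemma wr_partition_gt0 : 0 < wr_partition e lam.
Proof.
have w0 : wr_config e [ffun=> ord0].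
  by apply/'forall_forallP => x y; rewrite !ffunE implybT.
rewrite /wr_partition (bigD1 [ffun=> ord0]) //= ltr_pwDl ?exprn_gt0 //.
by apply: sumr_ge0 => chi _; rewrite exprn_ge0 // ltW.
Qed.

Lemma occupancy_gap : (0 < #|T|)%N ->
  (clique_occupancy - occupancy_fraction e lam)
    * ((2%:R * s ^+ d.+1 - 1) * (wr_partition e lam * #|T|%:R)) =
  2%:R * \sum_v pair_sum r lam (half_gap r d lam v).
Proof.
move=> T0.
rewrite -pair_sum_gapE; [|exact: refl_closure_refl|exact: refl_closure_sym
  |exact: card_ball_refl_closure].
rewrite -(sum_wr_config (fun k => _ - _ * k%:R)) /clique_occupancy /occupancy_fraction.
under [RHS]eq_bigr do rewrite mulrBl.
rewrite sumrB; under [X in _ = _ - X]eq_bigr do rewrite -mulrA.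
rewrite -!mulr_sumr -/(wr_partition e lam).
set N := \sum_(_ | _) _.
have := wr_partition_gt0; have := clique_occupancy_den_gt0.
have : 0 < #|T|%:R :> R by rewrite ltr0n.
move: (wr_partition e lam) (#|T|%:R) (_ - 1) => Z n D n0 D0 Z0.
by field; rewrite !gt_eqF.
Qed.

Lemma occupancy_le : (0 < #|T|)%N -> occupancy_fraction e lam <= clique_occupancy.
Proof.
move=> T0; rewrite -subr_ge0.
rewrite -(pmulr_lge0 _ (_ : 0 < (2%:R * s ^+ d.+1 - 1) * (wr_partition e lam * #|T|%:R))).
  rewrite occupancy_gap // mulr_ge0 // sumr_ge0 // => v _.
  apply: pair_sum_half_gap_ge0 => //; [exact: refl_closure_refl|exact: card_ball_refl_closure].
by rewrite !mulr_gt0 ?clique_occupancy_den_gt0 ?wr_partition_gt0 ?ltr0n.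
Qed.

Lemma occupancy_eqP : (0 < #|T|)%N ->
  occupancy_fraction e lam = clique_occupancy <-> transitive r.
Proof.
move=> T0; rewrite -(pair_sum_half_gap_eq0P refl_closure_refl refl_closure_sym
  card_ball_refl_closure lam0).
have := occupancy_gap T0; set c := (_ - 1) * _; set G := \sum_v _ => gapE.
have c0 : c != 0.
  by rewrite gt_eqF // !mulr_gt0 ?clique_occupancy_den_gt0 ?wr_partition_gt0 ?ltr0n.
split=> [h|G0]; first by move: gapE; rewrite h subrr mul0r; lra.
by move/eqP: gapE; rewrite G0 mulr0 mulf_eq0 (negbTE c0) orbF subr_eq0 => /eqP.
Qed.

Lemma transitive_disjoint_union : transitive r <-> disjoint_union_of_cliques e d.
Proof.
have rr := refl_closure_refl; have rs := refl_closure_sym.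
split=> [rt|[m [phi [/bij_inj phi_inj eE]]]]; last first.
  have rE x y : r x y = ((phi x).1 == (phi y).1).
    rewrite /refl_closure eE -(inj_eq phi_inj).
    by rewrite -pair_eqE /pair_eq; case: eqP; case: eqP.
  by move=> y x z; rewrite !rE => /eqP -> /eqP ->.
(* The classes of the equivalence [r] are its balls, all of size d + 1; they become the cliques. *)
pose P := equivalence_partition r [set: T].
have rE x y : r x y = (ball r x == ball r y).
  apply/idP/eqP => [xy|bxy].
    apply/setP => z; rewrite !inE; apply/idP/idP; last exact: rt.
    by apply: rt; rewrite rs.
  have : y \in ball r x by rewrite bxy inE rr.
  by rewrite inE.
have PE : P = [set ball r v | v in setT].
  by apply: eq_imset => v; apply/setP => y; rewrite !inE.
have ballP v : ball r v \in P by rewrite PE imset_f.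
have cardT : #|[set: T]| = (#|P| * d.+1)%N.
  apply: card_uniform_partition; first
    by rewrite PE => _ /imsetP[v _ ->]; exact: card_ball_refl_closure.
  apply: equivalence_partitionP => x y z _ _ _; split; first exact: rr.
  by move=> xy; apply/idP/idP; apply: rt; rewrite // rs.
have idxP v : (index v (enum (ball r v)) < d.+1)%N.
  by rewrite -(card_ball_refl_closure v) cardE index_mem mem_enum inE rr.
(* A vertex is located by the rank of its ball and its position in that ball. Vertices of one class
   share the same ball, hence the same enumeration. *)
pose phi v : 'I_#|P| * 'I_d.+1 :=
  (enum_rank_in (ballP v) (ball r v), inord (index v (enum (ball r v)))).
have phi1E x y : ((phi x).1 == (phi y).1) = r x y.
  rewrite rE /phi /=; apply/eqP/eqP => h; last by apply: enum_val_inj; rewrite !enum_rankK_in.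
  by rewrite -(enum_rankK_in (ballP x) (ballP x)) h enum_rankK_in.
have phi_inj : injective phi.
  move=> x y xy; have : r x y by rewrite -phi1E xy.
  rewrite rE => /eqP bxy; move/(congr1 (fun p => val p.2)): xy => /=.
  rewrite !inordK // bxy => /(congr1 (nth x (enum (ball r y)))).
  by rewrite !nth_index // mem_enum inE rE ?bxy.
exists #|P|, phi; split.
  by apply: inj_card_bij => //; rewrite card_prod !card_ord -cardT cardsT.
move=> x y; rewrite phi1E /refl_closure.
have [<-|xy] /= := eqVneq x y; first by rewrite hsimple.2 eqxx.
have [exy|//] := boolP (e x y); apply/esym.
apply: contraNneq xy => p2; apply/eqP/phi_inj.
rewrite [phi x]surjective_pairing [phi y]surjective_pairing; congr pair => //.
by apply/eqP; rewrite phi1E /refl_closure exy orbT.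
Qed.

End Configurations.

(** * The complete graph and the final comparison *)

Lemma complete_simple n : simple_graph (@complete_rel n).
Proof. by split=> [x y|x]; rewrite /complete_rel ?eqxx // eq_sym. Qed.

Lemma complete_regular d : regular (@complete_rel d.+1) d.
Proof.
move=> x; have -> : [set y | complete_rel x y] = [set~ x].
  by apply/setP => y; rewrite !inE /complete_rel eq_sym.
by rewrite cardsC1 card_ord.
Qed.

(** The equality case evaluates this without enumerating configurations: on a complete graph any two
    vertices are equal or adjacent, so transitivity is immediate. *)
Lemma occupancy_complete (R : realType) (d : nat) (lam : R) : 0 < lam ->
  occupancy_fraction (@complete_rel d.+1) lam = clique_occupancy d lam.
Proof.
move=> lam0; apply/(occupancy_eqP (complete_simple _) (@complete_regular d) lam0).
  by rewrite card_ord.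
by move=> y x z _ _; rewrite /refl_closure /complete_rel orbN.
Qed.

Theorem theorem1 (R : realType) (d : nat) (T : finType) (e : rel T)
    (hT : (0 < #|T|)%N) (hsimple : simple_graph e) (hreg : regular e d)
    (lam : R) (hlam : 0 < lam) :
  occupancy_fraction e lam <= occupancy_fraction (@complete_rel d.+1) lam /\
  (occupancy_fraction e lam = occupancy_fraction (@complete_rel d.+1) lam <->
     disjoint_union_of_cliques e d).
Proof.
rewrite occupancy_complete //; split; first exact: occupancy_le.
by rewrite occupancy_eqP // (transitive_disjoint_union hsimple hreg).
Qed.
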